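(* Let $p \geq 5$ be a prime number and let ${\rm C}_p$ denote the cyclic group of order $p$. Then \[ {\rm N}(\Theta({\rm C}_{p})) \equiv 1 \pmod{p^{2}}. \]
   Context: For a finite group $G$ and a family of independent commuting variables $\{x_g\}_{g\in G}$ indexed by the elements of $G$, the group determinant of $G$ is the polynomial $\Theta(G) := \det\left(x_{gh^{-1}}\right)_{g,h\in G}$ in $\mathbb{Z}[x_g : g \in G]$. For a polynomial $f$, ${\rm N}(f)$ denotes the number of terms of $f$, i.e. the number of distinct monomials appearing in $f$ with nonzero coefficient. *)

(* Defs.v *)
From mathcomp Require Import all_boot all_order all_algebra.
From mathcomp Require Import all_fingroup all_solvable.
From mathcomp Require Import ssrint.
From mathcomp.multinomials Require Import mpoly.

Set Implicit Arguments.
Unset Strict Implicit.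
Unset Printing Implicit Defensive.

Import GRing.Theory.
Local Open Scope ring_scope.

(* The variables of {mpoly int[#|G|]} are indexed by 'I_#|G|, identified with *)
(* G through enum_val; enum_rank_in is its inverse, and its value at elements *)
(* outside G is junk.                                                         *)
Definition gvar (gT : finGroupType) (G : {group gT}) (g : gT) :
    {mpoly int[#|G|]} :=
  'X_(enum_rank_in (group1 G) g).

Definition group_det (gT : finGroupType) (G : {group gT}) :
    {mpoly int[#|G|]} :=
  \det (\matrix_(i < #|G|, j < #|G|)
          gvar G (enum_val i * (enum_val j)^-1)%g).

Definition nterms (n : nat) (R : nzRingType) (f : {mpoly R[n]}) : nat :=
  size (msupp f).

(* Main.v *)
Require Import Defs.
From mathcomp Require Import all_boot all_order all_algebra.
From mathcomp Require Import all_fingroup all_solvable.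
From mathcomp.multinomials Require Import mpoly.
From mathcomp Require Import all_field ring zify.

(* Let z be a primitive p-th root of unity. The determinant factors as the
   product over k < p of sum_j z^(k j) x_j, so the coefficient of x^m is the
   sum of z^(weight w) over the words w of length p in which each letter j
   occurs m_j times, with weight w = sum_k k w_k. Rotating a word shifts its
   weight by s = sum_j j m_j; hence the coefficient is 0 unless p | s. If p | s
   and the coefficient vanishes, then the weights of these words are
   equidistributed mod p, and each of the p classes is stable under rotation;
   this contradicts the number of words being p! / prod_j m_j!. So the
   terms correspond to the m of degree p with p | s. Since h_p(1, z, ...,
   z^(p-1)) = 1, there are 1 + (C(2p-1, p-1) - 1) / p of them, and
   Wolstenholme's theorem C(2p-1, p-1) = 1 mod p^3 concludes. *)

Set Implicit Arguments.
Unset Strict Implicit.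
Unset Printing Implicit Defensive.

Import Order.TTheory GRing.Theory Num.Theory.
Local Open Scope ring_scope.

(** * Wolstenholme's theorem *)

Section Wolstenholme.
Variables (p : nat) (p_prime : prime p).

(* The sum is invariant under x |-> 2x, hence killed by 4 - 1 = 3. The term of
   index x = 0 is 0, because 0^-1 = 0. *)
Lemma sum_inv_sqr_Fp : (5 <= p)%N -> \sum_(x : 'F_p) x ^- 2 = 0.
Proof.
move=> p_ge5.
have natr_neq0 k : (0 < k < p)%N -> k%:R != 0 :> 'F_p.
  by case/andP=> k0 kp; rewrite -(dvdn_pcharf (pchar_Fp p_prime)) gtnNdvd.
have n2 : 2%:R != 0 :> 'F_p by apply: natr_neq0; lia.
have n3 : 3%:R != 0 :> 'F_p by apply: natr_neq0; lia.
set S := (X in X = 0).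
have scaleS : S = 2%:R ^- 2 * S.
  rewrite {1}/S (reindex_inj (mulfI n2)) /= mulr_sumr.
  by apply: eq_bigr => x _; rewrite exprMn invfM.
have : 3%:R * S = 0.
  have -> : 3%:R * S = 2%:R ^+ 2 * S - S by ring.
  rewrite [X in _ * X - _]scaleS mulrA mulfV ?mul1r ?subrr //.
  by rewrite expf_neq0.
by move/eqP; rewrite mulf_eq0 (negPf n3) /= => /eqP.
Qed.

(** By Pascal's rule two neighbours in row p - 1 add up to some C(p, k + 1), which p divides, so
    they are opposite mod p. *)
Lemma bin_pred_prime_Fp k : (k < p)%N -> ('C(p.-1, k))%:R = (-1) ^+ k :> 'F_p.
Proof.
elim: k => [|k IH] kp; first by rewrite bin0.
have Hp : p.-1.+1 = p by rewrite prednK // prime_gt0.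
have : ('C(p.-1.+1, k.+1))%:R = 0 :> 'F_p.
  by apply/eqP; rewrite Hp -(dvdn_pcharf (pchar_Fp p_prime)) prime_dvd_bin.
rewrite binS natrD IH ?(ltnW kp) // exprS mulN1r => /eqP.
by rewrite addr_eq0 => /eqP.
Qed.

Lemma sum_natr_Fp (V : zmodType) (F : 'F_p -> V) :
  \sum_(k < p) F k%:R = \sum_x F x.
Proof.
rewrite -(big_mkord predT (fun k => F k%:R)) -{1}(Fp_cast p_prime) big_mkord.
by apply: eq_bigr => x _; rewrite natr_Zp.
Qed.

(** For k > 0, k times C(p, k) / p equals C(p - 1, k - 1), a sign mod p that squaring removes. For k
    = 0 both sides are 0, since [1 %/ p] and the inverse of 0 are 0. *)
Lemma sqr_bin_divp_Fp k : (k < p)%N ->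
  ('C(p, k) %/ p)%N%:R ^+ 2 = k%:R ^- 2 :> 'F_p.
Proof.
have p_gt0 := prime_gt0 p_prime.
case: k => [|k] kp; first by rewrite bin0 divn_small ?prime_gt1 // invr0.
have k0 : k.+1%:R != 0 :> 'F_p.
  by rewrite -(dvdn_pcharf (pchar_Fp p_prime)) gtnNdvd.
have : (k.+1 * ('C(p, k.+1) %/ p) = 'C(p.-1, k))%N.
  apply/eqP; rewrite -(eqn_pmul2l p_gt0) mulnCA [(p * (_ %/ _))%N]mulnC.
  by rewrite divnK ?prime_dvd_bin // mul_bin_diag.
move/(congr1 (fun n => n%:R ^+ 2 : 'F_p)).
rewrite bin_pred_prime_Fp ?(ltnW kp) // natrM exprMn sqrr_sign.
by move/(canRL (mulKf _)) => -> //; rewrite ?mulr1 // expf_neq0.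
Qed.

(** Vandermonde's identity gives C(2p, p) = 2 + p^2 T, where T is congruent mod p to the sum of the
    k^-2, hence to 0. Halving is possible because p is odd. *)
Lemma wolstenholme : (5 <= p)%N -> ('C(2 * p - 1, p - 1) = 1 %[mod p ^ 3])%N.
Proof.
move=> p_ge5; have p_gt0 := prime_gt0 p_prime.
have p_dvd : (p %| \sum_(k < p) ('C(p, k) %/ p) ^ 2)%N.
  rewrite (dvdn_pcharf (pchar_Fp p_prime)) natr_sum.
  under eq_bigr => k _ do rewrite natrX sqr_bin_divp_Fp //.
  by rewrite (sum_natr_Fp (fun x => x ^- 2)) sum_inv_sqr_Fp.
have bin2p : ('C(2 * p, p) = 2 + p ^ 2 * \sum_(k < p) ('C(p, k) %/ p) ^ 2)%N.
  rewrite mul2n -addnn -binomial.Vandermonde big_ord_recr /= subnn bin0 binn.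
  rewrite -(big_mkord predT (fun k => 'C(p, k) * 'C(p, p - k))%N).
  rewrite -(big_mkord predT (fun k => ('C(p, k) %/ p) ^ 2)%N).
  rewrite !(big_ltn p_gt0) !bin0 subn0 binn divn_small ?prime_gt1 //= add0n.
  rewrite addnAC; congr addn; rewrite big_distrr /=.
  apply: eq_big_nat => k /andP[k_gt0 kp]; rewrite bin_sub ?(ltnW kp) //.
  rewrite -{1 2}(divnK (prime_dvd_bin p_prime _)) ?k_gt0 //.
  by rewrite mulnn expnMn mulnC.
have [q Dq] := dvdnP p_dvd.
have : ('C(2 * p, p) = 2 * 'C(2 * p - 1, p - 1))%N.
  have := mul_bin_diag (2 * p) p.-1; rewrite (prednK p_gt0) -!subn1 => E.
  by apply/eqP; rewrite -(eqn_pmul2l p_gt0) -E mulnCA mulnA.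
rewrite bin2p Dq => E.
have C_gt0 : (0 < 'C(2 * p - 1, p - 1))%N.
  by rewrite bin_gt0 leq_sub2r ?leq_pmull.
apply/eqP; rewrite eqn_mod_dvd // -(@Gauss_dvdr _ 2) ?coprimeXl //; last first.
  by rewrite coprime_sym prime_coprime // dvdn_prime2 // ltn_eqF //
     (leq_trans _ p_ge5).
by rewrite mulnBr -E muln1 addKn mulnCA -expnSr dvdn_mull.
Qed.
End Wolstenholme.

(** * Primitive roots of unity *)

Section PrimitiveRootRelations.
Variables (p : nat) (p_prime : prime p) (z : algC).
Hypothesis prim_z : p.-primitive_root z.

(* The minimal polynomial of z is 1 + X + ... + X^(p-1). *)
Lemma prim_root_coef_eq (c : 'I_p -> int) :
  \sum_r (c r)%:~R * z ^+ r = 0 -> forall r s, c r = c s.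
Proof.
have p_gt0 := prime_gt0 p_prime.
move: c; rewrite -(prednK p_gt0); set n := p.-1 => c sum0.
suffices coef_eq r : c r = c ord_max by move=> r s; rewrite !coef_eq.
(* Subtracting the last coefficient times 1 + z + ... + z^(p-1) = 0 leaves a relation of degree
   below p - 1. *)
pose d k := c (inord k) - c ord_max.
pose f : {poly rat} := \poly_(k < n) (d k)%:~R.
have sumz0 : \sum_(k < n.+1) z ^+ k = 0.
  have := subrX1 z n.+1; rewrite {1}(prednK p_gt0) prim_expr_order // subrr.
  move/esym/eqP; rewrite mulf_eq0 subr_eq0 => /orP[/eqP z1|/eqP //].
  have := prim_order_dvd prim_z 1; rewrite z1 expr1 eqxx dvdn1 => /eqP p1.
  by move: p_prime; rewrite p1.
have f_root : root (map_poly ratr f) z.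
  rewrite /root (@horner_coef_wide _ n); last first.
    by rewrite (leq_trans (size_poly _ _)) ?size_poly.
  apply/eqP; transitivity (\sum_(k < n.+1) (d k)%:~R * z ^+ k : algC).
    have dn0 : d n = 0.
      by rewrite /d (_ : inord n = ord_max) ?subrr //; apply/val_inj/inordK.
    rewrite big_ord_recr /= dn0 mul0r addr0; apply: eq_bigr => k _.
    by rewrite coef_map coef_poly ltn_ord /= ratr_int.
  under eq_bigr => k _ do rewrite /d inord_val intrB mulrBl.
  by rewrite big_split sum0 sumrN /= -mulr_sumr sumz0 mulr0 oppr0 addr0.
have [q [Dq _] dvd_q] := minCpolyP z.
have size_q : size q = n.+1.
  rewrite -(size_map_poly (@ratr algC)) -Dq (minCpoly_cyclotomic prim_z).
  by rewrite size_cyclotomic totient_prime // (prednK p_gt0).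
have f0 : f = 0.
  apply/eqP; apply: contraTT f_root => f_neq0; rewrite dvd_q.
  apply/negP=> /(dvdp_leq f_neq0); rewrite size_q leqNgt => /negP; apply.
  exact: size_poly.
move: (ltn_ord r); rewrite ltnS leq_eqVlt => /predU1P[r_max|r_lt].
  by congr c; apply: val_inj.
have := congr1 (fun g : {poly rat} => g`_r) f0.
rewrite coef_poly r_lt coef0 /d inord_val => /eqP.
by rewrite intr_eq0 subr_eq0 => /eqP.
Qed.
End PrimitiveRootRelations.

(** Stars and bars; the bound n on the values follows from the sum. *)
Lemma card_ffun_sum m n :
  #|[set f : {ffun 'I_m.+1 -> 'I_n.+1} | (\sum_i f i)%N == n]| = 'C(m + n, m).
Proof.
rewrite -card_ord_partitions -!sum1dep_card.
rewrite (reindex (fun t : m.+1.-tuple 'I_n.+1 => [ffun i => tnth t i])) /=.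
  apply: eq_bigl => t; rewrite big_tuple; congr (_ == _).
  by apply: eq_bigr => i _; rewrite ffunE.
exists (fun f => [tuple f i | i < m.+1]) => [t _|f _].
  by apply: eq_from_tnth => i; rewrite tnth_mktuple ffunE.
by apply/ffunP=> i; rewrite ffunE tnth_mktuple.
Qed.

(** Here 1 - z^i X = -z^i (X - z^-i), and z^-1 is again primitive; the product of the -z^i is the
    value of X^p - 1 at 0. *)
Lemma prod_sub_prim_root (F : fieldType) (p : nat) (z : F) :
  (0 < p)%N -> p.-primitive_root z ->
  \prod_(i < p) (1 - (z ^+ i)%:P * 'X) = 1 - 'X^p :> {poly F}.
Proof.
move=> p_gt0 prim_z.
have z_neq0 i : z ^+ i != 0.
  rewrite expf_neq0 //; apply/eqP=> z0; have := prim_expr_order prim_z.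
  by rewrite z0 expr0n gtn_eqF //= => /eqP; rewrite eq_sym oner_eq0.
have factor (y : F) : p.-primitive_root y ->
    \prod_(i < p) ('X - (y ^+ i)%:P) = 'X^p - 1.
  by move/factor_Xn_sub_1; rewrite big_mkord.
have prim_zV : p.-primitive_root z^-1.
  rewrite -[z^-1]mul1r -(prim_expr_order prim_z) -{2}(prednK p_gt0) exprSr.
  rewrite mulfK ?(z_neq0 1%N) // prim_root_exp_coprime //.
  by rewrite coprime_sym coprimenP.
have : \prod_(i < p) - (z ^+ i)%:P = -1 :> {poly F}.
  have := congr1 (fun f : {poly F} => f.[0]%:P) (factor _ prim_z).
  rewrite horner_prod hornerD hornerN hornerXn hornerC expr0n gtn_eqF // add0r.
  rewrite polyCN => <-; rewrite rmorph_prod /=.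
  by apply: eq_bigr => i _; rewrite hornerXsubC sub0r polyCN.
move=> prodN; transitivity (- 1 * ('X^p - 1) : {poly F}); last by ring.
rewrite -[X in X * _]prodN -(factor _ prim_zV) -big_split /=.
apply: eq_bigr => i _.
rewrite mulrBr mulNr -polyCN -polyCM mulNr exprVn mulfV ?z_neq0 //.
by rewrite !polyCN; ring.
Qed.

(** * Exponent vectors of degree p with weighted sum divisible by p *)

Section ZeroSumExponents.
Variables (p : nat) (p_prime : prime p) (z : algC).
Hypothesis prim_z : p.-primitive_root z.

(** Grouping by residues gives the shape of relation that [prim_root_coef_eq] handles. *)
Lemma sum_prim_root_expr (T : finType) (P : pred T) (w : T -> nat) :
  \sum_(x | P x) z ^+ w x =
  \sum_(r < p) (#|[set x | P x & w x == r %[mod p]]|%:Z)%:~R * z ^+ r.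
Proof.
rewrite (partition_big (fun x => Ordinal (ltn_pmod (w x) (prime_gt0 p_prime)))
  predT) //=.
apply: eq_bigr => r _; rewrite -pmulrn mulr_natl -sumr_const.
apply: eq_big => [x|x /andP[_ /eqP <-]]; last by rewrite prim_expr_mod.
by rewrite inE -val_eqE /= [(r %% p)%N]modn_small.
Qed.

Variable l : 'I_p -> 'I_p.
Hypothesis l_inj : injective l.

(* h_p(1, z, ..., z^(p-1)) = 1, where h_p is the complete symmetric polynomial:
   its generating series is 1 / (1 - X^p). *)
Lemma complete_sym_prim_root :
  \sum_(f : {ffun 'I_p -> 'I_p.+1} | (\sum_i f i)%N == p)
     z ^+ (\sum_i f i * l i)%N = 1.
Proof.
have p_gt0 := prime_gt0 p_prime.
pose a i : {poly algC} := (z ^+ i)%:P * 'X.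
(* Each geometric series is cut after degree p, so [H] agrees with 1 / (1 - X^p) up to degree p and
   expands over functions into ['I_p.+1]. *)
pose H := \prod_i \sum_(k < p.+1) a (l i) ^+ k.
have [q Dq] : exists q, (1 - 'X^p) * H = 1 + 'X^(p.+1) * q.
  rewrite -(prod_sub_prim_root p_gt0 prim_z) (reindex_inj l_inj) -big_split /=.
  elim/big_ind: _ => [|x y [q ->] [r ->]|i _].
  - by exists 0; rewrite mulr0 addr0.
  - by exists (q + r + 'X^(p.+1) * q * r); ring.
  exists (- (z ^+ (l i * p.+1))%:P).
  rewrite -/(a (l i)) -[1 - _]opprB mulNr -subrX1 opprB /a exprMn.
  by rewrite -rmorphXn -exprM mulrN mulrC.
have H0 : H`_0 = 1.
  have := congr1 (fun f : {poly algC} => f`_0) Dq.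
  by rewrite mulrBl mul1r coefB coefD !coefXnM coef1 p_gt0 subr0 addr0.
have : H`_p = 1.
  have := congr1 (fun f : {poly algC} => f`_p) Dq.
  rewrite mulrBl mul1r coefB coefD !coefXnM coef1 ltnn subnn H0 ltnSn.
  by rewrite gtn_eqF // add0r => /eqP; rewrite subr_eq0 => /eqP.
rewrite /H bigA_distr_bigA /= coef_sum => <-.
rewrite big_mkcond; apply: eq_bigr => f _.
have -> : \prod_i a (l i) ^+ f i =
    (z ^+ (\sum_i f i * l i)%N)%:P * 'X^(\sum_i f i)%N.
  rewrite -!prodrXr rmorph_prod -big_split; apply: eq_bigr => i _.
  by rewrite /a [LHS]exprMn -rmorphXn /= -exprM mulnC.
rewrite coefCM coefXn eq_sym.
by case: eqP; rewrite ?mulr1 ?mulr0.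
Qed.

(** By [complete_sym_prim_root], the residue classes have equal size once 1 is removed from class 0.
    With b the size of class 0, summing gives p (b - 1) + 1 = C(2p - 1, p - 1), and Wolstenholme's
    theorem applies. *)
Lemma card_zero_sum : (5 <= p)%N ->
  (#|[set f : {ffun 'I_p -> 'I_p.+1} |
     ((\sum_i f i)%N == p) && (p %| \sum_i f i * l i)%N]| = 1 %[mod p ^ 2])%N.
Proof.
move=> p_ge5; have p_gt0 := prime_gt0 p_prime.
pose P (f : {ffun 'I_p -> 'I_p.+1}) := (\sum_i f i)%N == p.
pose w (f : {ffun 'I_p -> 'I_p.+1}) := (\sum_i f i * l i)%N.
pose B (r : 'I_p) := [set f | P f & w f == r %[mod p]].
pose o : 'I_p := Ordinal p_gt0.
have := complete_sym_prim_root; rewrite (sum_prim_root_expr P w) => sumB.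
have cardB r : #|B r|%:Z - (r == o)%:Z = #|B o|%:Z - 1.
  rewrite -[1](_ : (o == o)%:Z = 1) ?eqxx //.
  pose c s := #|B s|%:Z - (s == o)%:Z.
  apply: (prim_root_coef_eq p_prime prim_z (c := c)).
  under eq_bigr => s _ do rewrite /c intrB mulrBl.
  rewrite big_split /= sumB sumrN (bigD1 o) //= expr0 mulr1.
  rewrite big1 ?addr0 ?subrr // => s /negPf ->.
  by rewrite mul0r.
have cardP : (\sum_r #|B r| = 'C(2 * p - 1, p - 1))%N.
  transitivity #|[set f | P f]|.
    rewrite -sum1dep_card.
    rewrite (partition_big (fun f => Ordinal (ltn_pmod (w f) p_gt0)) predT) //=.
    apply: eq_bigr => r _; rewrite -sum1_card; apply: eq_bigl => f.
    by rewrite inE -val_eqE /= [(r %% p)%N]modn_small.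
  have := card_ffun_sum p.-1 p; rewrite (prednK p_gt0) /P => ->.
  by rewrite -!subn1 mul2n -addnn addnBAC.
have -> : #|[set f : {ffun 'I_p -> 'I_p.+1} |
     ((\sum_i f i)%N == p) && (p %| \sum_i f i * l i)%N]| = #|B o|.
  by apply: eq_card => f; rewrite !inE /w eqn_mod_dvd // subn0.
have sumcard : p%:Z * (#|B o|%:Z - 1) + 1 = 'C(2 * p - 1, p - 1)%:Z.
  rewrite -cardP -[RHS]natz natr_sum.
  rewrite -[X in X + 1](_ : \sum_(r < p) (#|B o|%:Z - 1) = _).
    under [RHS]eq_bigr => r _
      do rewrite natz -[#|B r|%:Z](subrK (r == o)%:Z) cardB.
    rewrite [RHS]big_split /=; congr (_ + _).
    rewrite (bigD1 o) //= big1 ?addr0 //.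
    by move=> r /negPf ->.
  by rewrite sumr_const card_ord -mulr_natl natz.
have C_gt0 : (0 < 'C(2 * p - 1, p - 1))%N.
  by rewrite bin_gt0 leq_sub2r ?leq_pmull.
have := wolstenholme p_prime p_ge5 => /eqP; rewrite eqn_mod_dvd //.
move: #|B o| ('C(_, _)) sumcard C_gt0 => b C; clear -p_ge5 => sumcard C_gt0.
(* b = 0 would make the binomial coefficient equal to 1 - p < 0. *)
case: b sumcard => [|b] sumcard; first by lia.
have -> : (C - 1 = p * b)%N by lia.
rewrite expnS dvdn_pmul2l ?(leq_trans _ p_ge5) // => b_dvd.
by apply/eqP; rewrite eqn_mod_dvd ?subn1.
Qed.
End ZeroSumExponents.

(** * Words of given content *)

Lemma prime_ndvd_fact p k : prime p -> (k < p)%N -> ~~ (p %| k`!)%N.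
Proof.
move=> p_prime; elim: k => [|k IH] kp.
  by rewrite dvdn1 gtn_eqF ?prime_gt1.
by rewrite factS Euclid_dvdM // negb_or gtnNdvd //= IH // ltnW.
Qed.

Section Content.
Variables (q n : nat).

Definition content (w : {ffun 'I_q -> 'I_n}) : 'X_{1..n} :=
  (\sum_k U_(w k))%MM.

Lemma contentE w j : content w j = (\sum_k (w k == j))%N.
Proof. by rewrite mnm_sumE; apply: eq_bigr => k _; rewrite mnm1E. Qed.

Lemma mdeg_content w : mdeg (content w) = q.
Proof.
rewrite mdeg_sum (eq_bigr (fun=> 1%N)) => [|k _]; last by rewrite mdeg1.
by rewrite sum1_card card_ord.
Qed.

Lemma sum_content (F : 'I_n -> nat) w :
  (\sum_j content w j * F j = \sum_k F (w k))%N.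
Proof.
under eq_bigr => j _ do rewrite contentE big_distrl /=.
rewrite exchange_big /=; apply: eq_bigr => k _.
rewrite (bigD1 (w k)) //= eqxx mul1n big1 ?addn0 // => j /negPf.
by rewrite eq_sym => ->.
Qed.

Lemma mcoeff_prod_linear (R : comNzRingType) (a : 'I_q -> 'I_n -> R) m :
  (\prod_k \sum_j a k j *: 'X_j)@_m =
  \sum_(w | content w == m) \prod_k a k (w k).
Proof.
rewrite bigA_distr_bigA raddf_sum [RHS]big_mkcond /=; apply: eq_bigr => w _.
by rewrite scaler_prod mprodXE mcoeffZ mcoeffX mulr_natr mulrb.
Qed.

End Content.

Lemma mderiv_sumX_exp n (R : comNzRingType) (i : 'I_n) q :
  ((\sum_(j < n) 'X_j) ^+ q.+1)^`M(i) =
  (\sum_(j < n) 'X_j) ^+ q *+ q.+1 :> {mpoly R[n]}.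
Proof.
set S := \sum_(j < n) _.
have dS : S^`M(i) = 1 :> {mpoly R[n]}.
  rewrite raddf_sum (bigD1 i) //= mderivX mnm1E eqxx scale1r.
  rewrite (_ : (U_(i) - U_(i))%MM = 0%MM); last first.
    by apply/mnmP=> j; rewrite mnmBE subnn mnm0E.
  rewrite mpolyX0 big1 ?addr0 // => j /negPf ji.
  by rewrite mderivX mnm1E ji scale0r.
elim: q => [|q IH]; first by rewrite expr1 dS.
by rewrite exprS mderivM dS mul1r IH mulrnAr -exprS [RHS]mulrS.
Qed.

(** The words are counted by the coefficient of m in (sum_j X_j)^q. Differentiating in some X_i with
    m_i > 0 lowers q by one and brings out the factor m_i. *)
Lemma card_content q n (m : 'X_{1..n}) : mdeg m = q ->
  (#|[set w : {ffun 'I_q -> 'I_n} | content w == m]| * \prod_j (m j)`! = q`!)%N.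
Proof.
move=> deg_m; apply/eqP; rewrite -(eqr_nat int) natrM; apply/eqP.
have -> : #|[set w : {ffun 'I_q -> 'I_n} | content w == m]|%:R =
    ((\sum_(j < n) 'X_j) ^+ q)@_m :> int.
  rewrite -[q in RHS]card_ord -prodr_const.
  have := mcoeff_prod_linear (fun (_ : 'I_q) (_ : 'I_n) => 1 : int) m.
  under eq_bigr => k _ do under eq_bigr => j _ do rewrite scale1r.
  move=> ->; rewrite -sum1dep_card natr_sum; apply: eq_bigr => w _.
  by rewrite big1.
elim: q m deg_m => [|q IH] m deg_m.
  have /eqP -> : m == 0%MM by rewrite -mdeg_eq0 deg_m.
  by rewrite expr0 mcoeff1 eqxx big1 ?mul1r // => j _; rewrite mnm0E.
have [i mi_gt0] : exists i, (0 < m i)%N.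
  apply/existsP; apply: contra_eqT deg_m.
  rewrite negb_exists mdegE => /forallP m0.
  by rewrite big1 // => j _; apply/eqP; rewrite -leqn0 leqNgt.
pose m' := (m - U_(i))%MM.
have Dm : m = (m' + U_(i))%MM.
  apply/mnmP=> j; rewrite mnmDE mnmBE mnm1E subnK //.
  by case: eqP => [<-|].
have deg_m' : mdeg m' = q by move: deg_m; rewrite Dm mdegD mdeg1 addn1 => -[].
have := congr1 (mcoeff m') (mderiv_sumX_exp int i q).
rewrite mcoeff_deriv -Dm mcoeffMn => Dcoef.
rewrite factS natrM -(IH m' deg_m') mulrA mulr_natl -Dcoef.
rewrite -[_@_m *+ _]mulr_natr -mulrA -natrM; congr (_ * _%:R).
rewrite (bigD1 i) //= [in RHS](bigD1 i) //= mulnA -factS.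
have mi : (m' i).+1 = m i by rewrite [in RHS]Dm mnmDE mnm1E eqxx addn1.
rewrite mi; congr (_ * _)%N; apply: eq_bigr => j /negPf ji.
by rewrite [in LHS]Dm mnmDE mnm1E eq_sym ji addn0.
Qed.

(** * Rotation of words and nonvanishing of coefficients *)

Section ShiftedWords.
Variables (p : nat) (p_prime : prime p) (l : 'I_p -> 'I_p).

(** The exponent of z in the term that w selects when the product in [group_det_factor] is
    expanded. *)
Definition weight (w : {ffun 'I_p -> 'I_p}) : nat :=
  (\sum_(k < p) k * l (w k))%N.
Definition rotate (w : {ffun 'I_p -> 'I_p}) : {ffun 'I_p -> 'I_p} :=
  [ffun k => w (ordS k)].

Lemma rotate_inj : injective rotate.
Proof.
move=> v w /ffunP eq_vw; apply/ffunP=> k.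
by have := eq_vw (ord_pred k); rewrite !ffunE ord_predK.
Qed.

Lemma content_rotate w : content (rotate w) = content w.
Proof.
rewrite /content [RHS](reindex_inj (@ordS_inj p)) /=.
by apply: eq_bigr => k _; rewrite ffunE.
Qed.

(** Each letter moves back one position cyclically, so its multiplier drops by 1 mod p. *)
Lemma weight_rotate w :
  (weight (rotate w) + \sum_j content w j * l j = weight w %[mod p])%N.
Proof.
rewrite sum_content /weight [X in (_ + X)%N](reindex_inj (@ordS_inj p)).
rewrite [in RHS](reindex_inj (@ordS_inj p)) -big_split /=.
rewrite -modn_summ -[RHS]modn_summ; congr (_ %% _)%N; apply: eq_bigr => k _.
by rewrite ffunE [in RHS]modnMml mulSn addnC.
Qed.

Variable z : algC.
Hypothesis prim_z : p.-primitive_root z.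

(** Rotation permutes the words of content m, so the coefficient C satisfies z^s C = C with s the
    weighted sum of m; C != 0 forces z^s = 1. *)
Lemma dvdn_weight_of_coef_neq0 (m : 'X_{1..p}) :
  \sum_(w | content w == m) z ^+ weight w != 0 -> (p %| \sum_j m j * l j)%N.
Proof.
set C := \sum_(w | _) _ => C_neq0.
suffices : z ^+ (\sum_j m j * l j)%N * C = C.
  rewrite (prim_order_dvd prim_z) => /eqP.
  rewrite -subr_eq0 -{2}[C]mul1r -mulrBl mulf_eq0 (negPf C_neq0) orbF.
  by rewrite subr_eq0.
rewrite {1}/C (reindex_inj rotate_inj) mulr_sumr /=.
apply: eq_big => w; rewrite content_rotate // => /eqP <-.
rewrite -exprD addnC -(prim_expr_mod prim_z) weight_rotate.
by rewrite prim_expr_mod.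
Qed.

Definition words (m : 'X_{1..p}) (r : 'I_p) : {set {ffun 'I_p -> 'I_p}} :=
  [set w | content w == m & weight w == r %[mod p]].

(* By invariance under rotation, the number of words with a given letter at
   position does not depend on the position; summing over positions counts
   m j occurrences of j per word. *)
Lemma dvdn_card_words (m : 'X_{1..p}) r j :
  (p %| \sum_j m j * l j)%N -> (p %| m j * #|words m r|)%N.
Proof.
have p_gt0 := prime_gt0 p_prime => p_dvd.
have rotate_words w : (rotate w \in words m r) = (w \in words m r).
  rewrite !inE content_rotate; case: eqP => //= Dm.
  move: p_dvd; rewrite -Dm => /dvdnP[d Dd]; have := weight_rotate w.
  by rewrite Dd -modnDmr modnMl addn0 => ->.
pose N k := #|[set w in words m r | w k == j]|.
have N_ordS k : N (ordS k) = N k.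
  rewrite /N -!sum1dep_card [RHS](reindex_inj rotate_inj) /=.
  by apply: eq_bigl => w; rewrite rotate_words ffunE.
have N_const k : N k = N (Ordinal p_gt0).
  case: k; elim=> [|k IH] kp; first by congr (N _); apply: val_inj.
  rewrite -(IH (ltnW kp)) -[RHS]N_ordS; congr (N _); apply: val_inj.
  by rewrite /= modn_small.
have -> : (m j * #|words m r| = \sum_k N k)%N.
  rewrite mulnC -sum_nat_const.
  rewrite (eq_bigr (fun w : {ffun 'I_p -> 'I_p} => \sum_k (w k == j))%N).
    rewrite exchange_big; apply: eq_bigr => k _.
    by rewrite /N -sum1dep_card big_mkcondr; apply: eq_bigr => w _; case: eqP.
  by move=> w; rewrite inE => /andP[/eqP <- _]; rewrite contentE.
under eq_bigr => k _ do rewrite N_const.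
by rewrite sum_nat_const card_ord dvdn_mulr.
Qed.

(** If the sum vanished, all classes would have one size N, and N prod_j m_j! = (p - 1)!, so p would
    not divide N. By [dvdn_card_words] p would divide every m_j; a nonzero m_j then makes p divide
    m_j!, hence (p - 1)!. *)
Lemma coef_neq0 (m : 'X_{1..p}) :
  mdeg m = p -> (p %| \sum_j m j * l j)%N ->
  \sum_(w | content w == m) z ^+ weight w != 0.
Proof.
move=> deg_m p_dvd; have p_gt0 := prime_gt0 p_prime.
apply/eqP; rewrite (sum_prim_root_expr p_prime prim_z) => coef0.
have words_eq := prim_root_coef_eq p_prime prim_z coef0.

pose o : 'I_p := Ordinal p_gt0.
have card_words r : #|words m r| = #|words m o|.
  by case: (words_eq r o).
have card_m : (#|[set w : {ffun 'I_p -> 'I_p} | content w == m]| =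
    p * #|words m o|)%N.
  rewrite -sum1dep_card.
  rewrite (partition_big
    (fun w => Ordinal (ltn_pmod (weight w) p_gt0)) predT) //=.
  transitivity (\sum_r #|words m r|)%N.
    apply: eq_bigr => r _; rewrite -sum1_card; apply: eq_bigl => w.
    by rewrite inE -val_eqE /= [(r %% p)%N]modn_small.
  under eq_bigr => r _ do rewrite card_words.
  by rewrite sum_nat_const card_ord.
have := card_content deg_m; rewrite card_m.
have p_fact : p`! = (p * (p.-1)`!)%N by rewrite -{1}(prednK p_gt0) factS prednK.
rewrite p_fact -mulnA => /eqP; rewrite eqn_pmul2l // => /eqP Dfact.
have := prime_ndvd_fact p_prime (k := p.-1).
rewrite prednK // leqnn -Dfact Euclid_dvdM // => /(_ isT).
rewrite negb_or => /andP[ndvd_words /negP[]].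
have m_dvd j : (p %| m j)%N.
  have := dvdn_card_words o j p_dvd.
  by rewrite Euclid_dvdM // (negPf ndvd_words) orbF.
have [j mj_gt0] : exists j, (0 < m j)%N.
  apply/existsP; apply: contra_eqT deg_m.
  rewrite negb_exists mdegE => /forallP m0.
  by rewrite big1 ?ltn_eqF // => j _; apply/eqP; rewrite -leqn0 leqNgt.
by rewrite (bigD1 j) //= dvdn_mulr // dvdn_fact // p_gt0 dvdn_leq.
Qed.
End ShiftedWords.

(** * The group determinant of a cyclic group *)

Section CyclicGroup.
Variables (gT : finGroupType) (G : {group gT}) (g : gT).
Hypothesis genG : G :=: <[g]>%g.

(** The discrete logarithm in base g, inverse to the injection sending k to the index of g^k. *)
Lemma cyclic_log : exists2 l : 'I_#|G| -> 'I_#|G|, injective l &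
  forall i, enum_val i = (g ^+ l i)%g.
Proof.
have gG k : (g ^+ k)%g \in G by rewrite genG mem_cycle.
pose f (k : 'I_#|G|) := enum_rank_in (group1 G) (g ^+ k)%g.
have fE k : enum_val (f k) = (g ^+ k)%g by rewrite enum_rankK_in.
have f_inj : injective f.
  move=> i j /(congr1 (@enum_val _ _)) /eqP; rewrite !fE eq_expg_mod_order.
  have <- : #|G| = #[g]%g by rewrite genG.
  by rewrite !modn_small // => /eqP /val_inj.
exists (invF f_inj); first exact: (can_inj (f_invF f_inj)).
by move=> i; rewrite -fE f_invF.
Qed.

(* The rows of the Vandermonde matrix V are the characters of G, which are left
   eigenvectors of the group matrix. *)
Lemma group_det_factor (z : algC) (l : 'I_#|G| -> 'I_#|G|) :
    #|G|.-primitive_root z -> injective l ->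
    (forall i, enum_val i = (g ^+ l i)%g) ->
  map_mpoly intr (group_det G) =
  \prod_(k < #|G|) \sum_j z ^+ (k * l j) *: 'X_j :> {mpoly algC[#|G|]}.
Proof.
move=> prim_z l_inj lE.
pose a : 'rV[{mpoly algC[#|G|]}]_#|G| := \row_j (z ^+ l j)%:MP.
pose V := Vandermonde #|G| a.
pose d : 'rV[{mpoly algC[#|G|]}]_#|G| := \row_k \sum_j z ^+ (k * l j) *: 'X_j.
set M := \matrix_(i < #|G|, j < #|G|) gvar G (enum_val i * (enum_val j)^-1)%g.
have detV : \det V != 0.
  rewrite det_Vandermonde; apply/prodf_neq0 => i _; apply/prodf_neq0 => j ij.
  rewrite !mxE -mpolyCB mpolyC_eq0 subr_eq0 (eq_prim_root_expr prim_z).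
  by rewrite !modn_small // (inj_eq val_inj) (inj_eq l_inj) -val_eqE gtn_eqF.
apply: (mulfI detV); rewrite /group_det -/M -det_map_mx -det_mulmx mulrC.
transitivity (\det (diag_mx d *m V)); last first.
  rewrite det_mulmx det_diag; congr (_ * _).
  by apply: eq_bigr => k _; rewrite mxE.
congr (\det _); apply/matrixP=> k j.
rewrite mul_diag_mx !mxE.
(* Substituting hj for h turns the entry x_(h j^-1) into x_h, and multiplicativity of the character
   splits off the entry of [V] in column j. *)
pose f (h : 'I_#|G|) : 'I_#|G| :=
  enum_rank_in (group1 G) (enum_val h * enum_val j)%g.
have fE h : enum_val (f h) = (enum_val h * enum_val j)%g.
  by rewrite enum_rankK_in // groupM // enum_valP.
have f_inj : injective f.
  by move=> h h' /(congr1 (@enum_val _ _)); rewrite !fE => /mulIg /enum_val_inj.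
rewrite (reindex_inj f_inj) mulr_suml /=; apply: eq_bigr => h _.
rewrite !mxE fE mulgK /gvar enum_valK_in map_mpolyX.
have -> : z ^+ l (f h) = z ^+ (l h + l j).
  apply/eqP; rewrite (eq_prim_root_expr prim_z).
  have := eq_expg_mod_order g (l (f h)) (l h + l j).
  by rewrite expgD -!lE fE eqxx orderE -genG => <-.
rewrite -!rmorphXn /= -!exprM mulnDl exprD mpolyCM -!mul_mpolyC.
by rewrite [(k * _)%N]mulnC; ring.
Qed.
End CyclicGroup.

(** Integers embed in [algC], so terms can be counted where the determinant factors. *)
Lemma msupp_map_intr n (f : {mpoly int[n]}) m :
  (m \in msupp f) = ((map_mpoly intr f : {mpoly algC[n]})@_m != 0).
Proof. by rewrite mcoeff_msupp mcoeff_map_mpoly intr_eq0. Qed.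

Close Scope ring_scope.

Theorem theorem1 (p : nat) (p_prime : prime p) (p_ge5 : (5 <= p)%N)
    (gT : finGroupType) (G : {group gT}) (cycG : cyclic G)
    (oG : #|G| = p) :
  nterms (group_det G) = 1 %[mod p ^ 2].
Proof.
have [g genG] := cyclicP cycG; have [l l_inj lE] := cyclic_log genG.
subst p; have p_gt0 := cardG_gt0 G; have [z prim_z] := C_prim_root_exists p_gt0.
rewrite -(card_zero_sum p_prime prim_z l_inj p_ge5); congr (_ %% _)%N.
set B := [set f | _].
(* [m] maps [B] bijectively onto the support of the determinant. *)
pose m (f : {ffun 'I_#|G| -> 'I_#|G|.+1}) := [multinom f i : nat | i < #|G|].
have m_inj : injective m.
  move=> f h /mnmP eq_fh; apply/ffunP=> i; apply: val_inj.
  by have := eq_fh i; rewrite !mnmE.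
rewrite /nterms [RHS]cardE -(size_map m); apply/perm_size/uniq_perm.
- exact: msupp_uniq.
- by rewrite map_inj_uniq ?enum_uniq.
move=> m0; rewrite msupp_map_intr (group_det_factor genG prim_z l_inj lE).
rewrite mcoeff_prod_linear.
under eq_bigr => w _ do rewrite prodrXr -/(weight l w).
apply/idP/mapP => [coef_neq0|[f]]; last first.
  rewrite mem_enum inE => /andP[/eqP sum_f dvd_f] ->.
  apply: coef_neq0 => //.
    by rewrite mdegE -[RHS]sum_f; apply: eq_bigr => i _; rewrite mnmE.
  by move: dvd_f; congr (_ %| _)%N; apply: eq_bigr => i _; rewrite mnmE.
have deg_m0 : mdeg m0 = #|G|.
  have [w /eqP <-] : exists w : {ffun 'I_#|G| -> 'I_#|G|}, content w == m0.
    apply/existsP; apply: contraNT coef_neq0 => /existsPn no_w.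
    by rewrite big1 // => w Dw; have := no_w w; rewrite Dw.
  exact: mdeg_content.
have dvd_m0 := dvdn_weight_of_coef_neq0 prim_z coef_neq0.
(* An exponent is at most the degree, so [m0] comes from a function with values in ['I_#|G|.+1]. *)
have m0_le i : (m0 i < #|G|.+1)%N.
  by rewrite ltnS -[leqRHS]deg_m0 mdegE (bigD1 i) //= leq_addr.
pose f := [ffun i => Ordinal (m0_le i)].
exists f; last by apply/mnmP=> i; rewrite mnmE ffunE.
rewrite mem_enum inE; apply/andP; split.
  rewrite -[X in _ == X]deg_m0 mdegE; apply/eqP.
  by apply: eq_bigr => i _; rewrite ffunE.
by move: dvd_m0; congr (_ %| _)%N; apply: eq_bigr => i _; rewrite ffunE.
Qed.
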